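(* Let $\mathcal{C}$ be a root class of groups consisting of periodic groups and containing at least one infinite group. Then for any non-empty connected undirected graph $\Gamma = (\mathcal{V}, \mathcal{E})$ (loops and multiple edges allowed) with a non-empty set of edges, there exists a graph of groups $$\mathcal{G}(\Gamma) = \big(\Gamma,\ G_{v}\ (v \in \mathcal{V}),\ H_{e},\ \varphi_{\pm e}\ (e \in \mathcal{E})\big)$$ such that: 1) all groups $G_{v}$ ($v \in \mathcal{V}$) belong to the class $\mathcal{C}$; 2) all edge subgroups $H_{\varepsilon e}$ ($e \in \mathcal{E}$, $\varepsilon = \pm 1$) are non-trivial; 3) $\pi_{1}(\mathcal{G}(\Gamma))$ is residually a $\mathcal{C}$-group; 4) if $\mathcal{T}$ is a maximal tree in $\Gamma$ and $\sigma$ is a homomorphism of $\pi_{1}(\mathcal{G}(\Gamma), \mathcal{T})$ onto a group from $\mathcal{C}$, then for any $e \in \mathcal{E}$, $\varepsilon = \pm 1$, the relation $\ker\sigma \cap H_{\varepsilon e} \ne 1$ holds.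
   Context: Classes of groups are understood to be closed under isomorphism. A class of groups $\mathcal{C}$ is a root class if it contains non-trivial groups and is closed under taking subgroups, extensions, and Cartesian (unrestricted) products of the form $\prod_{y \in Y} X_{y}$, where $X, Y \in \mathcal{C}$ and $X_{y}$ is an isomorphic copy of $X$ for each $y \in Y$. A $\mathcal{C}$-group is a group belonging to $\mathcal{C}$. A group $X$ is residually a $\mathcal{C}$-group if for each $x \in X \setminus \{1\}$ there exists a homomorphism $\sigma$ of $X$ onto a group from $\mathcal{C}$ such that $x\sigma \ne 1$. A group is periodic if all its elements have finite order. Maps of groups are written on the right. A (directed) graph of groups $\mathcal{G}(\Gamma)$ over $\Gamma$ assigns to each vertex $v \in \mathcal{V}$ a group $G_v$, and to each edge $e \in \mathcal{E}$ a direction (i.e. a labelling of its ends as $e(1)$ and $e(-1)$), a group $H_e$, and injective homomorphisms $\varphi_{+e}\colon H_e \to G_{e(1)}$, $\varphi_{-e}\colon H_e \to G_{e(-1)}$. The groups $G_v$ are the vertex groups; the subgroups $H_{+e} = H_e\varphi_{+e} \leqslant G_{e(1)}$ and $H_{-e} = H_e\varphi_{-e} \leqslant G_{e(-1)}$ are the edge subgroups; $H_{\varepsilon e}$ for $\varepsilon = \pm 1$ means $H_{+e}$ or $H_{-e}$. For a maximal tree $\mathcal{T} = (\mathcal{V}, \mathcal{E}_{\mathcal{T}})$ in $\Gamma$, the fundamental group $\pi_1(\mathcal{G}(\Gamma), \mathcal{T})$ is the group generated by the generators of the groups $G_v$ ($v \in \mathcal{V}$) and symbols $t_e$ ($e \in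 \mathcal{E} \setminus \mathcal{E}_{\mathcal{T}}$), with defining relations: the relations of the $G_v$; $h\varphi_{+e} = h\varphi_{-e}$ ($e \in \mathcal{E}_{\mathcal{T}}$, $h \in H_e$); and $t_e^{-1}(h\varphi_{+e})t_e = h\varphi_{-e}$ ($e \in \mathcal{E} \setminus \mathcal{E}_{\mathcal{T}}$, $h \in H_e$). Up to isomorphism it does not depend on $\mathcal{T}$ and is denoted by $\pi_1(\mathcal{G}(\Gamma))$; the vertex groups $G_v$ embed naturally in it and are regarded as its subgroups. *)

(* Defs.v *)
From HB Require Import structures.
From mathcomp Require Import all_boot.
From mathcomp Require Import boolp classical_sets cardinality.

Set Implicit Arguments.
Unset Strict Implicit.
Unset Printing Implicit Defensive.

Local Open Scope classical_set_scope.
Local Open Scope group_scope.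
Local Open Scope quotient_scope.

(* Groups are arbitrary (possibly infinite) [groupType]s.  Between groups, a
   [{multiplicative X -> Y}] is a group homomorphism. *)

Definition trivial_set (X : groupType) (A : set X) : Prop := A `<=` [set 1].

Definition isomorphic (X Y : groupType) : Prop :=
  exists f : {multiplicative X -> Y}, bijective f.

Definition surjective (X Y : Type) (f : X -> Y) : Prop :=
  forall y, exists x, f x = y.

Definition hom_ker (X Y : groupType) (f : {multiplicative X -> Y}) : set X :=
  [set x | f x = 1].

Definition periodic (X : groupType) : Prop :=
  forall x : X, exists2 n : nat, (0 < n)%N & x ^+ n = 1.

Definition cprod (I : Type) (X : I -> groupType) : Type := forall i, X i.

Section CartesianProduct.
Variables (I : Type) (X : I -> groupType).
Implicit Types x y z : cprod X.

Definition cprod_one : cprod X := fun=> 1.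
Definition cprod_inv x : cprod X := fun i => (x i)^-1.
Definition cprod_mul x y : cprod X := fun i => x i * y i.

Fact cprod_mulA : associative cprod_mul.
Proof. by move=> x y z; apply: functional_extensionality_dep => i; apply: mulgA. Qed.
Fact cprod_mul1 : left_id cprod_one cprod_mul.
Proof. by move=> x; apply: functional_extensionality_dep => i; apply: mul1g. Qed.
Fact cprod_mulr1 : right_id cprod_one cprod_mul.
Proof. by move=> x; apply: functional_extensionality_dep => i; apply: mulg1. Qed.
Fact cprod_mulV : left_inverse cprod_one cprod_inv cprod_mul.
Proof. by move=> x; apply: functional_extensionality_dep => i; apply: mulVg. Qed.
Fact cprod_mulrV : right_inverse cprod_one cprod_inv cprod_mul.
Proof. by move=> x; apply: functional_extensionality_dep => i; apply: mulgV. Qed.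

HB.instance Definition _ := Choice.copy (cprod X) (forall i, X i).
HB.instance Definition _ := isGroup.Build (cprod X)
  cprod_mulA cprod_mul1 cprod_mulr1 cprod_mulV cprod_mulrV.
End CartesianProduct.

Definition group_class := groupType -> Prop.

Definition iso_closed (C : group_class) : Prop :=
  forall X Y : groupType, isomorphic X Y -> C X -> C Y.

Definition subgroup_closed (C : group_class) : Prop :=
  forall (X : groupType) (P : pred X) (S : subGroupType P), C X -> C S.

(* Short exact sequences 1 -> N -> X -> Q -> 1. *)
Definition extension_closed (C : group_class) : Prop :=
  forall (N X Q : groupType)
         (i : {multiplicative N -> X}) (p : {multiplicative X -> Q}),
    injective i -> surjective p -> range i = hom_ker p ->
    C N -> C Q -> C X.

(* The index set is the underlying set of a member of the class. *)
Definition power_closed (C : group_class) : Prop :=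
  forall (X Y : groupType) (F : Y -> groupType),
    (forall y, isomorphic X (F y)) -> C X -> C Y -> C (cprod F).

Definition root_class (C : group_class) : Prop :=
  [/\ iso_closed C,
      exists2 X : groupType, C X & ~ trivial_set [set: X],
      subgroup_closed C,
      extension_closed C
    & power_closed C].

Definition residually (C : group_class) (X : groupType) : Prop :=
  forall x : X, x <> 1 ->
    exists (Q : groupType) (s : {multiplicative X -> Q}),
      [/\ C Q, surjective s & s x <> 1].

Section Presentation.
Variable X : Type.

(* The letter (x, true) stands for x, and (x, false) for its inverse. *)
Definition word := {classic seq (X * bool)}.

Definition word_cat (u v : word) : word := (u ++ v)%SEQ.
Definition word_inv (u : word) : word := rev [seq (l.1, ~~ l.2) | l <- u].

Variable R : word -> word -> Prop.

Inductive pres_cong : word -> word -> Prop :=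
| pres_refl u : pres_cong u u
| pres_sym u v : pres_cong u v -> pres_cong v u
| pres_trans u v w : pres_cong u v -> pres_cong v w -> pres_cong u w
| pres_cat u u' v v' : pres_cong u u' -> pres_cong v v' ->
    pres_cong (word_cat u v) (word_cat u' v')
| pres_cancel x b : pres_cong [:: (x, b); (x, ~~ b)] [::]
| pres_rel u v : R u v -> pres_cong u v.

Definition pres_rel_bool : rel word := fun u v => `[< pres_cong u v >].

Fact pres_equiv : equiv_class_of pres_rel_bool.
Proof.
split=> [u|u v|v u w].
- exact/asboolP/pres_refl.
- by apply/asboolP/asboolP; apply: pres_sym.
- move=> /asboolP uv /asboolP vw; apply/asboolP; exact: pres_trans uv vw.
Qed.

Canonical pres_equiv_rel := EquivRelPack pres_equiv.

Definition presented : Type := {eq_quot pres_rel_bool}.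
HB.instance Definition _ := Choice.on presented.

Definition pres_class (u : word) : presented := \pi_({eq_quot pres_rel_bool}) u.

Definition pres_repr (a : presented) : word :=
  repr (a : {eq_quot pres_rel_bool}).

Lemma pres_classP u v : pres_class u = pres_class v <-> pres_cong u v.
Proof. by split=> [/eqmodP/asboolP|uv] //; apply/eqmodP/asboolP. Qed.

Lemma pres_class_repr (a : presented) : pres_class (pres_repr a) = a.
Proof. exact: reprK. Qed.

Lemma pres_repr_class u : pres_cong (pres_repr (pres_class u)) u.
Proof. by apply/pres_classP; rewrite pres_class_repr. Qed.

Definition pres_one : presented := pres_class [::].
Definition pres_mul (a b : presented) : presented :=
  pres_class (word_cat (pres_repr a) (pres_repr b)).
Definition pres_inv (a : presented) : presented := pres_class (word_inv (pres_repr a)).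

Lemma pres_mulE u v :
  pres_mul (pres_class u) (pres_class v) = pres_class (word_cat u v).
Proof. by apply/pres_classP; apply: pres_cat; apply: pres_repr_class. Qed.

Lemma word_invK u : pres_cong (word_cat (word_inv u) u) [::].
Proof.
elim: u => [|[x b] u IHu]; first exact: pres_refl.
rewrite /word_cat /word_inv /= rev_cons cat_rcons.
apply: (pres_trans _ IHu).
apply: (@pres_cat _ _ [:: (x, ~~ b), (x, b) & u] u (pres_refl _)).
apply: (@pres_cat [:: (x, ~~ b); (x, b)] [::] u u _ (pres_refl _)).
by have := pres_cancel x (~~ b); rewrite negbK.
Qed.

Lemma word_invV u : word_inv (word_inv u) = u.
Proof.
rewrite /word_inv map_rev revK -map_comp -[RHS]map_id.
by apply: eq_map => -[x b] /=; rewrite negbK.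
Qed.

Lemma word_mulrV u : pres_cong (word_cat u (word_inv u)) [::].
Proof. by rewrite -{1}(word_invV u); apply: word_invK. Qed.

Fact pres_mulA : associative pres_mul.
Proof.
move=> a b c; rewrite -(pres_class_repr a) -(pres_class_repr b).
by rewrite -(pres_class_repr c) !pres_mulE /word_cat catA.
Qed.
Fact pres_mul1 : left_id pres_one pres_mul.
Proof. by move=> a; rewrite -(pres_class_repr a) pres_mulE. Qed.
Fact pres_mulr1 : right_id pres_one pres_mul.
Proof. by move=> a; rewrite -(pres_class_repr a) pres_mulE /word_cat cats0. Qed.
Fact pres_mulV : left_inverse pres_one pres_inv pres_mul.
Proof.
move=> a; rewrite -{2}(pres_class_repr a) pres_mulE.
exact/pres_classP/word_invK.
Qed.
Fact pres_mulrV : right_inverse pres_one pres_inv pres_mul.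
Proof.
move=> a; rewrite -{1}(pres_class_repr a) pres_mulE.
exact/pres_classP/word_mulrV.
Qed.

HB.instance Definition _ := isGroup.Build presented
  pres_mulA pres_mul1 pres_mulr1 pres_mulV pres_mulrV.

End Presentation.

(* The ends of an edge form an unordered set {a, b}; it is a singleton exactly
   when the edge is a loop. *)
Record graph := Graph {
  vertex : Type;
  edge : Type;
  ends : edge -> set vertex;
  ends_pair : forall e, exists a b, ends e = [set a; b] }.

Section Graphs.
Variable Gam : graph.
Implicit Type T : set (edge Gam).

Inductive walk T : vertex Gam -> seq (edge Gam) -> vertex Gam -> Prop :=
| walk_nil u : walk T u [::] u
| walk_cons u v w e s : T e -> ends e = [set u; v] -> walk T v s w ->
    walk T u (e :: s) w.

Definition connected_by T : Prop := forall u v, exists s, walk T u s v.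

(* A circuit is a non-empty closed walk without repeated edges. *)
Definition acyclic T : Prop :=
  forall u s, walk T u s u -> uniq (s : seq {classic edge Gam}) -> s = [::].

(* T is the edge set of a tree containing all the vertices. *)
Definition maximal_tree T : Prop := connected_by T /\ acyclic T.

Definition connected_graph : Prop := connected_by [set: edge Gam].
End Graphs.

(* The sign +1 is [true] and -1 is [false]: [eend e true] is e(1). *)
Record graph_of_groups (Gam : graph) := GraphOfGroups {
  vgroup : vertex Gam -> groupType;
  egroup : edge Gam -> groupType;
  eend : edge Gam -> bool -> vertex Gam;
  eend_ends : forall e, ends e = [set eend e true; eend e false];
  emb : forall e eps, {multiplicative egroup e -> vgroup (eend e eps)};
  emb_inj : forall e eps, injective (emb e eps) }.

Section FundamentalGroup.
Variables (Gam : graph) (G : graph_of_groups Gam).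

Definition edge_subgroup (e : edge Gam) (eps : bool) :
    set (vgroup G (eend G e eps)) :=
  range (emb G e eps).

Variable T : set (edge Gam).

Inductive pi1_gen : Type :=
| VGen v of vgroup G v
| EGen e of ~ T e.

Definition vlet v (g : vgroup G v) : pi1_gen * bool := (VGen g, true).

(* Each vertex group is presented by its multiplication table. *)
Inductive pi1_rel : word pi1_gen -> word pi1_gen -> Prop :=
| rel_vertex v (g g' : vgroup G v) :
    pi1_rel [:: vlet g; vlet g'] [:: vlet (g * g')]
| rel_tree e (h : egroup G e) : T e ->
    pi1_rel [:: vlet (emb G e true h)] [:: vlet (emb G e false h)]
| rel_stable e (nTe : ~ T e) (h : egroup G e) :
    pi1_rel [:: (EGen nTe, false); vlet (emb G e true h); (EGen nTe, true)]
            [:: vlet (emb G e false h)].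

Definition pi1 : groupType := presented pi1_rel.

Definition vincl v (g : vgroup G v) : pi1 := pres_class pi1_rel [:: vlet g].

Definition pi1_edge_subgroup (e : edge Gam) (eps : bool) : set pi1 :=
  @vincl (eend G e eps) @` @edge_subgroup e eps.

End FundamentalGroup.

Arguments edge_subgroup {Gam} G e eps.
Arguments pi1 {Gam} G T.
Arguments vincl {Gam G} T {v} g.
Arguments pi1_edge_subgroup {Gam} G T e eps.

(* Main.v *)
From HB Require Import structures.
Require Import Defs.
From mathcomp Require Import all_boot.
From mathcomp Require Import boolp classical_sets functions cardinality.

Set Implicit Arguments.
Unset Strict Implicit.
Unset Printing Implicit Defensive.

Local Open Scope classical_set_scope.
Local Open Scope group_scope.

(** The edge groups are copies of one group H in C, on which the fundamental
    group induces an automorphism of infinite order.  It acts with larger and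
    larger order on quotients of H that homomorphisms to C-groups can see one
    at a time, while a C-group, being periodic, cannot see them all together.
    Let A be an infinite group in C.

    The obstruction.  Let two copies of A act on a set Om, and let a, b be
    the two actions of one element g0 <> 1.  Put H = A^Om and let every vertex
    group be a permutational wreath product H : A, with the first action at
    one vertex v0 and the second action at all the others; the edge groups
    are H, glued identically, except that at a loop one of the two embeddings
    is twisted by tau = ab.  If a homomorphism s of the fundamental group is
    injective on one copy of H, then it is so on all of them, because the
    graph is connected.  For an edge e0 at v0 some element z of the image
    then acts on s(H) as tau does: z is the stable letter if e0 is a loop, and
    otherwise a product of two elements g0 taken at the two ends of e0.  So if
    tau has infinite order on Om, then z has infinite order, which a periodic
    image does not allow ([periodic_quotient_kernel]).

    Residuality.  H is normal in the fundamental group, and the quotient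
    is a free product of copies of A and of a free group.  Elements are
    brought to the form h w with h in H and w a reduced word
    ([normal_form_exists]).  Two families of homomorphisms to C-groups suffice.
    If w is non-empty, it survives in a group of triangular permutations of
    A^n built for w, an iterated wreath product of n copies of A
    ([alternating_detector]): the free factor of the i-th letter multiplies
    the i-th coordinate, but only when the coordinate before it, which that
    factor fixes, shows that the earlier letters have been read.  If w is
    empty then h is seen by a level: the same construction for the word (ab)^n
    gives actions of the two copies of A through a C-group Q_n on a set Om_n,
    on which (ab)^n moves the starting point.  So Om is taken to be the
    disjoint union of the Om_n, on which ab has infinite order, and
    restriction of functions to Om_n extends from H to a homomorphism of the
    fundamental group to the C-group A^Om_n : Q_n ([level_hom]).

    Since A is infinite, A^nat and all powers A^Om with Om inside A^nat are in
    C ([class_power_seq]); all the sets Om that occur are such. *)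

(** * Homomorphisms and subgroups *)

Section Homs.
Variables (X Y : groupType) (f : {multiplicative X -> Y}).

Lemma hom1 : f 1 = 1.
Proof. by apply: (mulIg (f 1)); rewrite -gmulfM !mul1g. Qed.

Lemma homV x : f x^-1 = (f x)^-1.
Proof. by apply: (mulIg (f x)); rewrite -gmulfM !mulVg hom1. Qed.

Lemma hom_injective : (forall x, f x = 1 -> x = 1) -> injective f.
Proof.
move=> f_ker x y xy; apply/divg1_eq/f_ker.
by rewrite gmulfM homV xy mulgV.
Qed.
End Homs.

Definition make_hom (X Y : groupType) (f : X -> Y)
    (fM : {morph f : x y / x * y}) : {multiplicative X -> Y} :=
  HB.pack f (isMultiplicative.Build X Y f fM).

Section SubgroupType.
Variables (X : groupType) (S : pred X) (S_closed : group_closed S).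
Definition subgroup_type of group_closed S : Type := {x | S x}.
Local Notation sT := (subgroup_type S_closed).
HB.instance Definition _ := SubChoice.copy sT {x | S x}.
HB.instance Definition _ := SubChoice_isSubGroup.Build X S sT S_closed.
End SubgroupType.

Section KernelImage.
Variables (X Y : groupType) (f : {multiplicative X -> Y}).

Definition ker_pred : pred X := fun x => `[< f x = 1 >].
Definition im_pred : pred Y := fun y => `[< exists x, f x = y >].

Fact ker_closed : group_closed ker_pred.
Proof.
split; first exact/asboolP/hom1.
move=> x y /asboolP fx /asboolP fy; apply/asboolP.
by rewrite gmulfM homV fx fy mulgV.
Qed.

Fact im_closed : group_closed im_pred.
Proof.
split; first by apply/asboolP; exists 1; apply: hom1.
move=> _ _ /asboolP[x <-] /asboolP[y <-]; apply/asboolP.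
by exists (x * y^-1); rewrite gmulfM homV.
Qed.

Definition ker_group : groupType := subgroup_type ker_closed.
Definition im_group : groupType := subgroup_type im_closed.

Lemma corestrict_proof x : im_pred (f x).
Proof. by apply/asboolP; exists x. Qed.

Definition corestrict_fun (x : X) : im_group :=
  exist _ (f x) (corestrict_proof x).

Fact corestrictM : {morph corestrict_fun : x y / x * y}.
Proof. by move=> x y; apply: val_inj; rewrite /= gmulfM. Qed.

Definition corestrict : {multiplicative X -> im_group} := make_hom corestrictM.

Lemma corestrict_surj : surjective corestrict.
Proof. by case=> y y_im; case/asboolP: (y_im) => x fx; exists x; apply: val_inj. Qed.

Definition ker_incl : {multiplicative ker_group -> X} :=
  make_hom (fun x y : ker_group => erefl (val x * val y)).
End KernelImage.

(** * Closure properties of a root class *)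

Section RootClass.
Variables (C : group_class) (C_root : root_class C).

Let C_iso : iso_closed C. Proof. by case: C_root. Qed.
Let C_sub : subgroup_closed C. Proof. by case: C_root. Qed.
Let C_ext : extension_closed C. Proof. by case: C_root. Qed.
Let C_pow : power_closed C. Proof. by case: C_root. Qed.

Lemma class_image (X Y : groupType) (f : {multiplicative X -> Y}) : C Y -> C (im_group f).
Proof. exact: C_sub. Qed.

Lemma class_embed (X Y : groupType) (f : {multiplicative X -> Y}) :
  injective f -> C Y -> C X.
Proof.
move=> f_inj CY; have CI := class_image f CY.
have corK y : exists x, corestrict f x = y by apply: corestrict_surj.
pose g y := projT1 (cid (corK y)).
have gK : cancel g (corestrict f) by move=> y; rewrite /g; case: cid.
have Kg : cancel (corestrict f) g.
  by move=> x; apply: f_inj; have /(congr1 val) := gK (corestrict f x).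
apply: C_iso CI; exists (make_hom (can2_gmulfM Kg gK)).
by exists (corestrict f).
Qed.

(** X is an extension of the kernel of p by its image, which is a subgroup of a
    C-group. *)
Lemma class_extension (X Q : groupType) (p : {multiplicative X -> Q}) :
  C (ker_group p) -> C Q -> C X.
Proof.
move=> CK CQ.
apply: (C_ext (i := ker_incl p) (p := corestrict p)) CK (class_image p CQ).
- exact: val_inj.
- exact: corestrict_surj.
- apply/seteqP; split=> x /=.
    by case=> -[y y_ker] _ <-; apply: val_inj; apply/asboolP.
  move=> /(congr1 val) /= px.
  have x_ker : ker_pred p x by apply/asboolP.
  by exists (exist _ x x_ker).
Qed.

(** The powers in the definition of a root class are indexed by C-groups.  A
    subset Om of a C-group will do: extend functions on Om by 1. *)
Lemma class_power (Om : Type) (X Z : groupType) (i : Om -> Z) :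
  injective i -> C X -> C Z -> C (cprod (fun _ : Om => X)).
Proof.
move=> i_inj CX CZ.
have CXZ : C (cprod (fun _ : Z => X)).
  by apply: (C_pow _ CX CZ) => _; exists (make_hom (fun x y : X => erefl (x * y)));
     exists id.
pose ext (h : Om -> X) (z : Z) : X :=
  if pselect (exists w, i w = z) is left zi then h (projT1 (cid zi)) else 1.
have extE h w : ext h (i w) = h w.
  rewrite /ext; case: pselect => [wi|[]]; last by exists w.
  by congr h; apply: i_inj; case: cid.
have extM : {morph (ext : cprod (fun _ : Om => X) -> cprod (fun _ : Z => X))
              : g h / g * h}.
  move=> g h; apply: functional_extensionality_dep => z.
  by rewrite /ext /mul /= /cprod_mul; case: pselect; rewrite ?mulg1.
apply: (class_embed (f := make_hom extM)) CXZ => g h gh.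
apply: functional_extensionality_dep => w.
by rewrite -!extE; apply: (congr1 (fun k => k (i w)) gh).
Qed.
End RootClass.

(** * Permutational wreath products *)

Record raction (Om : Type) (Q : groupType) := RAction {
  act :> Om -> Q -> Om;
  act1 : forall w, act w 1 = w;
  actM : forall w q r, act w (q * r) = act (act w q) r }.

Section Wreath.
Variables (A : groupType) (Om : Type) (Q : groupType) (to : raction Om Q).

(** The product of A^Om by Q acts on Om * A, on the right, by
    (w, y) . (h, q) = (w . q, y * h w); this dictates the multiplication. *)
Definition wreath of raction Om Q : Type := (cprod (fun _ : Om => A) * Q)%type.
Local Notation W := (wreath to).
Implicit Types (x y z : W) (h : cprod (fun _ : Om => A)) (q r : Q).

Definition wmul x y : W := (fun w => x.1 w * y.1 (to w x.2), x.2 * y.2).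
Definition wone : W := (fun=> 1, 1).
Definition winv x : W := (fun w => (x.1 (to w x.2^-1))^-1, x.2^-1).

Lemma wreath_eq x y : x.1 =1 y.1 -> x.2 = y.2 -> x = y.
Proof.
by case: x y => [h q] [g r] /= hg <-; congr (_, _); apply: functional_extensionality_dep.
Qed.

Fact wmulA : associative wmul.
Proof. by move=> x y z; apply: wreath_eq => [w|] /=; rewrite ?actM mulgA. Qed.
Fact wmul1 : left_id wone wmul.
Proof. by move=> x; apply: wreath_eq => [w|] /=; rewrite ?act1 mul1g. Qed.
Fact wmulr1 : right_id wone wmul.
Proof. by move=> x; apply: wreath_eq => [w|] /=; rewrite mulg1. Qed.
Fact wmulV : left_inverse wone winv wmul.
Proof. by move=> x; apply: wreath_eq => [w|] /=; rewrite mulVg. Qed.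
Fact wmulrV : right_inverse wone winv wmul.
Proof.
by move=> x; apply: wreath_eq => [w|] /=; rewrite -?actM mulgV ?act1 ?mulgV.
Qed.

HB.instance Definition _ := Choice.copy W (cprod (fun _ : Om => A) * Q)%type.
HB.instance Definition _ := isGroup.Build W wmulA wmul1 wmulr1 wmulV wmulrV.

Definition wbase h : W := (h, 1).
Definition wtop q : W := (fun=> 1, q).

Lemma wbaseM : {morph wbase : h g / h * g}.
Proof.
by move=> h g; apply: wreath_eq => [w|] /=; rewrite ?act1 ?mulg1.
Qed.

Lemma wtopM : {morph wtop : q r / q * r}.
Proof. by move=> q r; apply: wreath_eq => [w|] //=; rewrite mulg1. Qed.

Lemma wreathE x : x = wbase x.1 * wtop x.2.
Proof. by apply: wreath_eq => [w|] /=; rewrite ?mulg1 ?mul1g. Qed.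

Lemma wtop_wbase q h : wtop q * wbase h = wbase (fun w => h (to w q)) * wtop q.
Proof. by apply: wreath_eq => [w|] /=; rewrite ?mulg1 ?mul1g. Qed.

Definition wquot : {multiplicative W -> Q} :=
  make_hom (fun x y : W => erefl (x.2 * y.2)).

(** The kernel of the projection to Q is the base A^Om. *)
Lemma class_wreath (C : group_class) :
  root_class C -> C (cprod (fun _ : Om => A)) -> C Q -> C W.
Proof.
move=> C_root CH CQ; apply: (class_extension C_root (p := wquot)) CQ.
have vM : {morph (fun x : ker_group wquot => (val x).1) : x y / x * y}.
  move=> [x x_ker] y; apply: functional_extensionality_dep => w /=.
  have /= x1 : wquot x = 1 by apply/asboolP.
  by rewrite /mul /= /cprod_mul x1 act1.
apply: (class_embed C_root (f := make_hom vM)) CH => -[x xk] [y yk] /= xy.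
apply: val_inj; apply: wreath_eq => [w|] /=; first by rewrite xy.
by move/asboolP: xk => /= ->; move/asboolP: yk.
Qed.
End Wreath.

Arguments wbase {A Om Q} to h.
Arguments wtop A {Om Q} to q.

(** * Separating alternating words *)

Section WreathAction.
Variables (A : groupType) (Om : Type) (Q : groupType) (to : raction Om Q).

Let wact (p : Om * A) (x : wreath A to) : Om * A := (to p.1 x.2, p.2 * x.1 p.1).

Fact wact1 p : wact p 1 = p.
Proof. by case: p => w y; rewrite /wact /= act1 mulg1. Qed.

Fact wactM p x y : wact p (x * y) = wact (wact p x) y.
Proof. by rewrite /wact /= actM mulgA. Qed.

Definition wreath_act : raction (Om * A) (wreath A to) := RAction wact1 wactM.
End WreathAction.

(** Words are read from right to left: the head of the list is the last factor
    of the product, so that words grow by [cons]. *)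
Section WordValue.
Variables (D : Type) (A Q : groupType).

Definition word_value (rho : D -> {multiplicative A -> Q}) (W : seq (D * A)) : Q :=
  foldr (fun l x => x * rho l.1 l.2) 1 W.

Lemma word_value_cat rho W1 W2 :
  word_value rho (W2 ++ W1) = word_value rho W1 * word_value rho W2.
Proof. by elim: W2 => [|l W2 IH] /=; rewrite ?mulg1 // IH mulgA. Qed.
End WordValue.

Definition head_colour_neq (D : eqType) (A : Type) (d : D) (W : seq (D * A)) : bool :=
  if W is l :: _ then d != l.1 else true.

(** A letter (d, q) stands for the element q of the copy of A of colour d; these
    are the reduced words of the free product of the copies. *)
Fixpoint alternating (D : eqType) (A : groupType) (W : seq (D * A)) : bool :=
  if W is l :: W' then
    [&& l.2 != 1, head_colour_neq l.1 W' & alternating W']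
  else true.

Section Detectors.
Variables (C : group_class) (C_root : root_class C) (A : groupType) (CA : C A).
Variables (iN : nat -> A) (iN_inj : injective iN).

(** Used twice: A^nat is in C since nat embeds in A, and then A^nat is itself an
    index group for the power A^Om. *)
Lemma class_power_seq (Om : Type) (i : Om -> nat -> A) :
  injective i -> C (cprod (fun _ : Om => A)).
Proof.
move=> i_inj; have CAN := class_power C_root iN_inj CA CA.
exact: (class_power C_root (Z := cprod (fun _ : nat => A)) i_inj CA CAN).
Qed.

(** An action on det_point of the free product of copies of A indexed by D,
    through a C-group, that recognises when W has been read: the start becomes
    done after the whole of W, and not after a proper prefix.  The stability
    condition is what makes it possible to add a letter: if its colour is not
    the last one of W, then its copy of A preserves being done, and can be
    made to act on a new coordinate at the done points only. *)
Record detector (D : eqType) (W : seq (D * A)) := Detector {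
  det_group : groupType;
  det_point : Type;
  det_act : raction det_point det_group;
  det_hom : D -> {multiplicative A -> det_group};
  det_code : det_point -> nat -> A;
  det_done : det_point -> Prop;
  det_start : det_point;
  det_class : C det_group;
  det_code_inj : injective det_code;
  det_done_stable : forall d q w, head_colour_neq d W ->
    det_done (det_act w (det_hom d q)) <-> det_done w;
  det_done_end : det_done (det_act det_start (word_value det_hom W));
  det_done_early : forall W1 W2, W = W2 ++ W1 -> W2 <> [::] ->
    ~ det_done (det_act det_start (word_value det_hom W1)) }.

Lemma detector_nil (D : eqType) : @detector D [::].
Proof.
pose to : raction unit A :=
  @RAction _ _ (fun w _ => w) (fun=> erefl) (fun _ _ _ => erefl).
apply: (@Detector _ _ A unit to
  (fun=> make_hom (fun x y : A => erefl (x * y))) (fun _ _ => 1) (fun=> True) tt)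
  => //; first by move=> [] [].
by move=> W1 [].
Qed.

(** One more letter (s, g): the new points carry an additional coordinate in A,
    which the copy of A of colour s multiplies at the done points, and the new
    points are done when that coordinate is g. *)
Section DetectorCons.
Variables (D : eqType) (s : D) (g : A) (W : seq (D * A)) (dt : detector W).
Hypotheses (g_neq1 : g != 1) (sW : head_colour_neq s W).

Local Notation Q := (det_group dt).
Local Notation Om := (det_point dt).
Local Notation to := (det_act dt).
Local Notation rho := (det_hom dt).
Local Notation done := (@det_done _ _ dt).
Local Notation o := (det_start dt).

Let switch (d : D) (q : A) (w : Om) : A := if (d == s) && `[< done w >] then q else 1.
Let rho'_fun (d : D) (q : A) : wreath A to := (switch d q, rho d q).

(** For d = s this needs that the copy of A of colour s preserves being done. *)
Fact cons_homM d : {morph rho'_fun d : q r / q * r}.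
Proof.
move=> q r; apply: wreath_eq => [w|] /=; last by rewrite gmulfM.
rewrite /switch; case: eqP => [->|_] /=; last by rewrite mulg1.
rewrite (asbool_equiv_eq (det_done_stable q w sW)).
by case: ifP; rewrite ?mulg1.
Qed.

Let rho' d := make_hom (cons_homM d).
Let to' := wreath_act A to.
Let code (p : Om * A) (n : nat) : A := if n is n'.+1 then det_code p.1 n' else p.2.

(** While W is being read no proper prefix is done, so the new coordinate, even
    if s has already occurred in W, remains 1. *)
Fact cons_early W1 W2 : W = W2 ++ W1 ->
  to' (o, 1) (word_value rho' W1) = (to o (word_value rho W1), 1).
Proof.
elim: W1 W2 => [|l W1 IH] W2 WE; first by rewrite !act1.
rewrite [word_value _ _]/= [word_value _ (_ :: _)]/= !actM (IH (rcons W2 l)) ?cat_rcons //.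
rewrite /= /switch; case: asboolP => [dn|_]; last by rewrite andbF mulg1.
case: (@det_done_early _ _ dt W1 (rcons W2 l)) => //; first by rewrite cat_rcons.
by case: W2 {WE}.
Qed.

Lemma detector_cons : detector ((s, g) :: W).
Proof.
apply: (@Detector _ _ (wreath A to) (Om * A) to' rho' code (fun p => p.2 = g) (o, 1)).
- apply: class_wreath (det_class dt) => //.
  exact: class_power_seq (@det_code_inj _ _ dt).
- move=> [w y] [w' y'] /= E; congr (_, _).
    apply: (@det_code_inj _ _ dt); apply: functional_extensionality_dep => n.
    exact: (congr1 (fun f => f n.+1) E).
  exact: (congr1 (fun f => f 0%N) E).
- by move=> d q [w y] /= /negPf ds; rewrite /switch ds mulg1.
- rewrite [word_value _ _]/= actM (@cons_early W [::]) //= /switch eqxx /= mul1g.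
  by case: asboolP => // -[]; apply: det_done_end.
- move=> W1 [|l W2] // [_ WE] _; rewrite (cons_early WE) /=.
  by apply/eqP; rewrite eq_sym.
Qed.
End DetectorCons.

Lemma alternating_detector (D : eqType) (W : seq (D * A)) :
  alternating W -> detector W.
Proof.
elim: W => [_|[s g] W IH /= /and3P[g1 sW /IH dt]]; first exact: detector_nil.
exact: detector_cons.
Qed.

Lemma detector_moves (D : eqType) (W : seq (D * A)) (dt : detector W) :
  W <> [::] ->
  det_act dt (det_start dt) (word_value (det_hom dt) W) <> det_start dt.
Proof.
move=> W0 E; have := @det_done_end _ _ dt; rewrite E -(act1 (det_act dt) (det_start dt)).
by apply: (@det_done_early _ _ dt [::] W); rewrite ?cats0.
Qed.
End Detectors.

(** * Presented groups and fundamental groups *)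

Section Presented.
Variables (X : Type) (R : word X -> word X -> Prop).
Local Notation P := (presented R).

Definition pres_gen (x : X) : P := pres_class R [:: (x, true)].

Lemma pres_class_cat u v : pres_class R (word_cat u v) = pres_class R u * pres_class R v.
Proof. by rewrite -pres_mulE. Qed.

Lemma pres_genV x : pres_class R [:: (x, false)] = (pres_gen x)^-1.
Proof.
apply/esym/mulg1_eq; rewrite -pres_class_cat.
exact/pres_classP/(pres_cancel R x true).
Qed.

Lemma presented_ind (S : P -> Prop) :
  S 1 -> (forall a x, S a -> S (a * pres_gen x)) ->
  (forall a x, S a -> S (a * (pres_gen x)^-1)) -> forall a, S a.
Proof.
move=> S1 Sgen SgenV a; rewrite -(pres_class_repr a).
elim/last_ind: (pres_repr a) => [|u [x b] IH] //.
rewrite -cats1 (pres_class_cat u [:: (x, b)]).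
by case: b; [apply: Sgen | rewrite pres_genV; apply: SgenV].
Qed.

Variables (Y : groupType) (f : X -> Y).

Definition word_eval (u : word X) : Y :=
  foldr (fun l y => (if l.2 then f l.1 else (f l.1)^-1) * y) 1 u.

Lemma word_eval_cat u v : word_eval (word_cat u v) = word_eval u * word_eval v.
Proof. by elim: u => [|l u IH] /=; rewrite ?mul1g // IH mulgA. Qed.

Lemma presented_lift :
  (forall u v, R u v -> word_eval u = word_eval v) ->
  exists F : {multiplicative P -> Y}, forall x, F (pres_gen x) = f x.
Proof.
move=> evalR.
have eval_cong u v : pres_cong R u v -> word_eval u = word_eval v.
  elim=> {u v} [u|u v _ ->|u v w _ -> _ ->|u u' v v' _ uu' _ vv'|x b|u v] //.
  - by rewrite !word_eval_cat uu' vv'.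
  - by case: b; rewrite /= mulg1 (mulgV, mulVg).
  - exact: evalR.
have FM : {morph (fun a : P => word_eval (pres_repr a)) : a b / a * b}.
  move=> a b; rewrite -word_eval_cat; apply: eval_cong.
  exact: pres_repr_class.
exists (make_hom FM) => x /=; rewrite (eval_cong _ _ (pres_repr_class R _)) /=.
exact: mulg1.
Qed.
End Presented.

Section FundamentalGroups.
Variables (Gam : graph) (G : graph_of_groups Gam) (T : set (edge Gam)).
Local Notation Pi := (pi1 G T).

(** Defined for all edges, with the value 1 on the tree, in order not to carry
    a proof that e is outside T. *)
Definition stable (e : edge Gam) : Pi :=
  if pselect (~ T e) is left nTe then pres_gen (@pi1_rel Gam G T) (EGen G nTe)
  else 1.

Lemma stableE e (nTe : ~ T e) : stable e = pres_gen (@pi1_rel Gam G T) (EGen G nTe).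
Proof.
by rewrite /stable; case: pselect => // nTe'; rewrite (Prop_irrelevance nTe' nTe).
Qed.

Lemma vinclM v : {morph @vincl Gam G T v : g h / g * h}.
Proof.
move=> g h; apply/esym; rewrite -(pres_class_cat _ [:: vlet T g] [:: vlet T h]).
exact/pres_classP/pres_rel/rel_vertex.
Qed.

Definition vincl_hom v : {multiplicative vgroup G v -> Pi} := make_hom (@vinclM v).

Lemma vincl_tree e (h : egroup G e) : T e ->
  vincl T (emb G e true h) = vincl T (emb G e false h).
Proof. by move=> Te; apply/pres_classP/pres_rel/rel_tree. Qed.

Lemma vincl_stable e (h : egroup G e) : ~ T e ->
  vincl T (emb G e true h) = stable e * vincl T (emb G e false h) * (stable e)^-1.
Proof.
move=> nTe.
have <- : (stable e)^-1 * vincl T (emb G e true h) * stable e =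
    vincl T (emb G e false h).
  have /pres_classP := pres_rel (rel_stable nTe h).
  rewrite (pres_class_cat _ [:: _] [:: _; _]) (pres_class_cat _ [:: _] [:: _]).
  by rewrite pres_genV (stableE nTe) mulgA.
by rewrite !mulgA mulgV mul1g mulgK.
Qed.

Lemma pi1_ind (S : Pi -> Prop) :
  S 1 -> (forall a v (g : vgroup G v), S a -> S (a * vincl T g)) ->
  (forall a e, ~ T e -> S a -> S (a * stable e)) ->
  (forall a e, ~ T e -> S a -> S (a * (stable e)^-1)) ->
  forall a, S a.
Proof.
move=> S1 Sv Se SeV; elim/presented_ind => // a [v g|e nTe] Sa.
- exact: Sv.
- by rewrite -stableE; apply: Se.
- by rewrite -[(_)^-1](homV (vincl_hom v)); apply: Sv.
- by rewrite -stableE; apply: SeV.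
Qed.

(** The universal property of the fundamental group. *)
Lemma pi1_lift (Y : groupType) (fv : forall v, {multiplicative vgroup G v -> Y})
    (fe : edge Gam -> Y) :
  (forall e h, T e -> fv _ (emb G e true h) = fv _ (emb G e false h)) ->
  (forall e h, ~ T e ->
     fv _ (emb G e true h) = fe e * fv _ (emb G e false h) * (fe e)^-1) ->
  exists F : {multiplicative Pi -> Y},
    (forall v (g : vgroup G v), F (vincl T g) = fv v g) /\
    (forall e, ~ T e -> F (stable e) = fe e).
Proof.
move=> f_tree f_stable.
pose f (x : pi1_gen G T) : Y :=
  match x with VGen v g => fv v g | EGen e _ => fe e end.
have [u v|F FE] := @presented_lift _ (@pi1_rel Gam G T) Y f.
  case=> {u v} [v g g'|e h Te|e nTe h] /=; rewrite !mulg1.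
  - by rewrite gmulfM.
  - exact: f_tree.
  - by rewrite f_stable // !mulgA mulVg mul1g mulgVK.
by exists F; split=> [v g|e nTe]; rewrite ?(stableE nTe) FE.
Qed.
End FundamentalGroups.

(** * Walks *)

Lemma set2_eq (T : Type) (u v x y : T) : [set u; v] = [set x; y] ->
  (u = x /\ v = y) \/ (u = y /\ v = x).
Proof.
move=> E.
have [ux|uy] : [set x; y] u by rewrite -E; left.
- have [vx|vy] : [set x; y] v by rewrite -E; right.
  + have [yu|yv] : [set u; v] y by rewrite E; right.
      by right; rewrite yu ux vx -ux.
    by left; rewrite -yv.
  + by left.
- have [vx|vy] : [set x; y] v by rewrite -E; right.
  + by right.
  + have [xu|xv] : [set u; v] x by rewrite E; left.
      by left; rewrite xu uy vy.
    by right; rewrite xv.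
Qed.

Section Walks.
Variables (Gam : graph) (G : graph_of_groups Gam) (T : set (edge Gam)).

Lemma connected_transport (P : vertex Gam -> Prop) :
  connected_by T ->
  (forall e, T e -> P (eend G e true) <-> P (eend G e false)) ->
  forall u v, P u -> P v.
Proof.
move=> T_conn P_edge u v; have [s] := T_conn u v.
elim=> {u s v} [//|u v w e s Te uv _ IH Pu]; apply: IH.
have [P12 P21] := P_edge e Te.
have E := eend_ends G e; rewrite uv in E.
by case: (set2_eq E) => -[uE vE]; rewrite vE; [apply: P12|apply: P21]; rewrite -uE.
Qed.

(** A loop is a circuit of length one. *)
Lemma tree_edge_not_loop e : maximal_tree T -> T e ->
  eend G e true <> eend G e false.
Proof.
move=> [_ T_acyclic] Te loop.
have walk_e : walk T (eend G e true) [:: e] (eend G e true).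
  apply: (walk_cons Te) (walk_nil _ _).
  by rewrite (eend_ends G e) -loop.
by have := T_acyclic _ _ walk_e isT.
Qed.
End Walks.

(** * The graph of groups *)

Section Construction.
Variables (C : group_class) (C_root : root_class C) (A : groupType) (CA : C A).
Variables (iN : nat -> A) (iN_inj : injective iN) (g0 : A) (g0_neq1 : g0 != 1).

Fixpoint ab_word n : seq (bool * A) :=
  if n is n'.+1 then [:: (false, g0), (true, g0) & ab_word n'] else [::].

Lemma ab_word_alternating n : alternating (ab_word n).
Proof. by elim: n => [|n IH] //=; rewrite g0_neq1 IH; case: n {IH}. Qed.

Lemma ab_word_value (Q : groupType) (rho : bool -> {multiplicative A -> Q}) n :
  word_value rho (ab_word n) = (rho true g0 * rho false g0) ^+ n.
Proof. by elim: n => [|n IH] //=; rewrite IH -mulgA expgSr. Qed.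

(* Level n separates the n-th power of ab from 1. *)
Variable lev : forall n, detector C (ab_word n).

Definition point : Type := {n & det_point (lev n)}.
Definition mkpoint n (w : det_point (lev n)) : point := existT _ n w.
Lemma mkpoint_inj n : injective (@mkpoint n).
Proof. by move=> w w'; apply: (@eq_from_Tagged nat). Qed.

Definition base_group : groupType := cprod (fun _ : point => A).

Definition colour_act_fun (c : bool) (w : point) (q : A) : point :=
  mkpoint (det_act (lev (tag w)) (tagged w) (det_hom (lev (tag w)) c q)).

Fact colour_act1 c w : colour_act_fun c w 1 = w.
Proof. by case: w => n w; rewrite /colour_act_fun /= hom1 act1. Qed.

Fact colour_actM c w q r :
  colour_act_fun c w (q * r) = colour_act_fun c (colour_act_fun c w q) r.
Proof. by rewrite /colour_act_fun /= gmulfM actM. Qed.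

Definition colour_act c : raction point A := RAction (colour_act1 c) (colour_actM c).

(** A point (n, w) of the disjoint union is coded by n, put in A by iN, followed
    by the code of w. *)
Lemma class_base : C base_group.
Proof.
pose code (w : point) (k : nat) : A :=
  if k is k'.+1 then det_code (tagged w) k' else iN (tag w).
apply: (class_power_seq C_root CA iN_inj (i := code)) => -[n w] [n' w'] E.
have nn' : n = n' by apply: iN_inj; apply: (congr1 (fun f => f 0%N) E).
case: n' / nn' w' E => w' E; congr existT.
apply: (@det_code_inj _ _ _ _ (lev n)); apply: functional_extensionality_dep => k.
exact: (congr1 (fun f => f k.+1) E).
Qed.

(** Translation of functions by ab: conjugation by an element that acts on the
    points as ab does. *)
Definition shift_fun (h : base_group) : base_group :=
  fun w => h (colour_act false (colour_act true w g0) g0).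
Definition unshift (h : base_group) : base_group :=
  fun w => h (colour_act true (colour_act false w g0^-1) g0^-1).

Lemma unshiftK : cancel unshift shift_fun.
Proof.
move=> h; apply: functional_extensionality_dep => w.
by rewrite /shift_fun /unshift -actM mulgV act1 -actM mulgV act1.
Qed.

Lemma shift_funK : cancel shift_fun unshift.
Proof.
move=> h; apply: functional_extensionality_dep => w.
by rewrite /shift_fun /unshift -actM mulVg act1 -actM mulVg act1.
Qed.

Definition ab_prod n : det_group (lev n) :=
  det_hom (lev n) true g0 * det_hom (lev n) false g0.

Lemma iter_shift (h : base_group) m n (w : det_point (lev n)) :
  iter m shift_fun h (mkpoint w) =
  h (mkpoint (det_act (lev n) w (ab_prod n ^+ m))).
Proof.
elim: m w => [|m IH] w; first by rewrite /= act1.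
rewrite iterS /shift_fun -/shift_fun [colour_act _ _ _]/= IH.
by rewrite expgS !actM.
Qed.

(** The m-th power of ab moves the starting point of level m. *)
Lemma shift_infinite_order m : (0 < m)%N -> exists h, iter m shift_fun h <> h.
Proof.
case: m => // m _.
pose w0 := mkpoint (det_start (lev m.+1)).
exists (fun w => if `[< w = w0 >] then g0 else 1) => /(congr1 (fun h => h w0)).
rewrite iter_shift -ab_word_value; case: asboolP => [/mkpoint_inj E|_].
  by case: (detector_moves (dt := lev m.+1) _ E).
by case: asboolP => // _ E; move: g0_neq1; rewrite -E eqxx.
Qed.

Variables (Gam : graph) (v0 : vertex Gam).

Definition edge_end (e : edge Gam) (eps : bool) : vertex Gam :=
  let ab := cid (ends_pair e) in
  if eps then projT1 ab else projT1 (cid (projT2 ab)).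

Lemma edge_end_ends e : ends e = [set edge_end e true; edge_end e false].
Proof. exact: projT2 (cid (projT2 (cid (ends_pair e)))). Qed.

Definition vcolour (v : vertex Gam) : bool := `[< v = v0 >].
Definition loop (e : edge Gam) : bool := `[< edge_end e true = edge_end e false >].

Definition vertex_group (v : vertex Gam) : groupType := wreath A (colour_act (vcolour v)).

Definition twist (e : edge Gam) (h : base_group) : base_group :=
  if loop e then shift_fun h else h.
Definition untwist (e : edge Gam) (h : base_group) : base_group :=
  if loop e then unshift h else h.

Lemma untwistK e : cancel (untwist e) (twist e).
Proof. by rewrite /twist /untwist => h; case: loop => //; rewrite unshiftK. Qed.

Lemma twistK e : cancel (twist e) (untwist e).
Proof. by rewrite /twist /untwist => h; case: loop => //; rewrite shift_funK. Qed.

(** Only loops are twisted, since in the fundamental group the two embeddings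
    of the group of a tree edge are identified with no conjugation, for every
    choice of the tree. *)
Definition edge_emb_fun (e : edge Gam) (eps : bool) (h : base_group) :
    vertex_group (edge_end e eps) :=
  wbase (colour_act (vcolour (edge_end e eps))) (if eps then twist e h else h).

Fact edge_embM e eps : {morph edge_emb_fun e eps : g h / g * h}.
Proof.
move=> g h; rewrite /edge_emb_fun -wbaseM; congr wbase.
by case: eps => //; rewrite /twist; case: loop.
Qed.

Definition edge_emb e eps := make_hom (edge_embM e eps).

Fact edge_emb_inj e eps : injective (edge_emb e eps).
Proof.
by move=> g h /(congr1 fst) /=; case: eps => // /(can_inj (@twistK e)).
Qed.

Definition twisted_graph : graph_of_groups Gam :=
  @GraphOfGroups Gam vertex_group (fun=> base_group) edge_end edge_end_ends
    edge_emb edge_emb_inj.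
Local Notation G := twisted_graph.

Lemma class_vertex_group v : C (vgroup G v).
Proof. by apply: class_wreath => //; apply: class_base. Qed.

Lemma edge_subgroup_nontrivial e eps : ~ trivial_set (edge_subgroup G e eps).
Proof.
move=> triv; pose h : base_group := fun=> g0.
have /triv /= eh1 : edge_subgroup G e eps (emb G e eps h) by exists h.
have : h = 1 by apply: (@emb_inj _ G e eps); rewrite hom1.
move=> /(congr1 (fun f => f (mkpoint (det_start (lev 0))))) /= E.
by move: g0_neq1; rewrite -[g0]/(h (mkpoint (det_start (lev 0)))) E eqxx.
Qed.

Section Pi1.
Variable T : set (edge Gam).
Hypothesis T_tree : maximal_tree T.
Local Notation Pi := (pi1 G T).
Local Notation st := (stable G T).

Lemma tree_not_loop e : T e -> loop e = false.
Proof. by move=> Te; apply/asboolP; apply: (tree_edge_not_loop (G := G)) Te. Qed.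

Definition vbase v (h : base_group) : Pi :=
  @vincl _ G T v (wbase (colour_act (vcolour v)) h).
Definition vtop v (q : A) : Pi := @vincl _ G T v (wtop A (colour_act (vcolour v)) q).

Lemma vbaseM v : {morph vbase v : g h / g * h}.
Proof. by move=> g h; rewrite /vbase wbaseM vinclM. Qed.

Lemma vtopM v : {morph vtop v : q r / q * r}.
Proof. by move=> q r; rewrite /vtop wtopM vinclM. Qed.

Lemma vbase1 v : vbase v 1 = 1.
Proof. exact: (hom1 (make_hom (@vbaseM v))). Qed.

Lemma vtop1 v : vtop v 1 = 1.
Proof. exact: (hom1 (make_hom (@vtopM v))). Qed.

Lemma vincl_split v (x : vgroup G v) : vincl T x = vbase v x.1 * vtop v x.2.
Proof. by rewrite [x in LHS]wreathE vinclM. Qed.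

Lemma vtop_vbase v q h :
  vtop v q * vbase v h = vbase v (fun w => h (colour_act (vcolour v) w q)) * vtop v q.
Proof. by rewrite /vtop /vbase -!vinclM wtop_wbase. Qed.

Lemma vbase_twist e h : ~ T e ->
  vbase (edge_end e true) (twist e h) = st e * vbase (edge_end e false) h * (st e)^-1.
Proof. exact: (@vincl_stable _ G T e h). Qed.

(** Within the fundamental group there is only one copy of the base H: the tree
    edges, which are not twisted, identify those of adjacent vertices. *)
Lemma vbase_eq u v h : vbase u h = vbase v h.
Proof.
apply: (connected_transport (G := G) (P := fun u => vbase u h = vbase v h) T_tree.1)
  (erefl (vbase v h)) => e Te.
have /= E := @vincl_tree _ G T e h Te.
have {}E : vbase (edge_end e true) h = vbase (edge_end e false) h.
  by move: E; rewrite /edge_emb_fun /twist tree_not_loop.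
by rewrite /= E.
Qed.

(** Functions on the disjoint union are restricted to the points of level n, and
    the two copies of A act there through the group of that level; the stable
    letter of a loop goes to the element ab, which realises the twist. *)
Lemma level_hom n : exists F : {multiplicative Pi -> wreath A (det_act (lev n))},
  forall v h, F (vbase v h) = wbase (det_act (lev n)) (fun w => h (mkpoint w)).
Proof.
pose f v (x : vgroup G v) : wreath A (det_act (lev n)) :=
  (fun w => x.1 (mkpoint w), det_hom (lev n) (vcolour v) x.2).
have fM v : {morph f v : x y / x * y}.
  by move=> x y; apply: wreath_eq => [w|] //=; rewrite gmulfM.
have f_base v h : f v (wbase (colour_act (vcolour v)) h) =
    wbase (det_act (lev n)) (fun w => h (mkpoint w)).
  by apply: wreath_eq => [w|] //=; rewrite hom1.
pose fe e : wreath A (det_act (lev n)) :=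
  if loop e then wtop A (det_act (lev n)) (ab_prod n) else 1.
have [e h Te|e h nTe|F [Fv _]] := @pi1_lift _ G T _ (fun v => make_hom (@fM v)) fe.
- by rewrite /= /edge_emb_fun /= !f_base /twist tree_not_loop.
- rewrite /= /edge_emb_fun /= !f_base /fe /twist; case: loop; last by rewrite mul1g divg1.
  rewrite wtop_wbase mulgK; congr wbase; apply: functional_extensionality_dep => w.
  by rewrite -(iter_shift h 1).
by exists F => v h; rewrite /vbase Fv /= f_base.
Qed.

Lemma vbase_eq1 v h : vbase v h = 1 -> h = 1.
Proof.
move=> h1; apply: functional_extensionality_dep => -[n w].
have [F FE] := level_hom n; have := FE v h; rewrite h1 hom1.
by move=> /(congr1 (fun x => x.1 w)) /= <-.
Qed.

(** * Homomorphisms to periodic groups *)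

(** If s were injective on one copy of the base, it would be so on all of them,
    and some z in Q would conjugate the image of the base as ab does, hence
    have infinite order. *)
Lemma periodic_quotient_kernel (Q : groupType) (s : {multiplicative Pi -> Q}) :
  connected_graph Gam -> periodic Q ->
  (exists e, edge_end e true = v0) ->
  forall e eps, ~ trivial_set (hom_ker s `&` pi1_edge_subgroup G T e eps).
Proof.
move=> Gam_conn Q_per [e0 e0v0] e1 eps triv.
pose faithful v := forall h, s (vbase v h) = 1 -> h = 1.
have faithful1 : faithful (edge_end e1 eps).
  move=> h sh1; apply: (@vbase_eq1 (edge_end e1 eps)); apply: triv; split=> //.
  exists (wbase (colour_act (vcolour (edge_end e1 eps))) h) => //.
  exists (if eps then untwist e1 h else h) => //=.
  by rewrite /edge_emb_fun; case: (eps) => //; rewrite untwistK.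
pose t e := s (if `[< T e >] then 1 else st e).
have s_twist e h :
    s (vbase (edge_end e true) (twist e h)) =
    t e * s (vbase (edge_end e false) h) * (t e)^-1.
  rewrite /t; case: asboolP => [Te|nTe]; last by rewrite vbase_twist // !gmulfM homV.
  by rewrite hom1 mul1g divg1 /twist tree_not_loop // (vbase_eq _ (edge_end e false)).
have faithful_edge e : faithful (edge_end e true) <-> faithful (edge_end e false).
  split=> fe h sh.
    apply: (can_inj (@twistK e)); rewrite [RHS](_ : _ = 1); last first.
      by rewrite /twist; case: loop.
    by apply: fe; rewrite s_twist sh mulg1 mulgV.
  rewrite -(untwistK e h) in sh *.
  move/eqP: sh; rewrite s_twist mulg_eq1 invgK => /eqP sh.
  rewrite (fe (untwist e h)); first by rewrite /twist; case: loop.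
  by apply: (mulgI (t e)); rewrite sh mulg1.
have faithful_all v : faithful v.
  apply: (connected_transport (G := G) (P := faithful) Gam_conn) faithful1 => e _.
  exact: faithful_edge.
(* For a loop z is the stable letter; otherwise it is the product of g0 at v0,
   acting as a, and of g0 at the other end, acting as b. *)
have [z zE] : exists z : Q, forall h, z * s (vbase v0 h) = s (vbase v0 (shift_fun h)) * z.
  case e0_loop: (loop e0).
    exists (t e0) => h; have := s_twist e0 h; rewrite /twist e0_loop e0v0 => ->.
    by move/asboolP: e0_loop; rewrite e0v0 => <-; rewrite mulgVK.
  pose u := edge_end e0 false.
  have e0_untw h : t e0 * s (vbase u h) = s (vbase v0 h) * t e0.
    by have := s_twist e0 h; rewrite /twist e0_loop e0v0 => ->; rewrite mulgVK.
  have v0_colour : vcolour v0 = true by apply/asboolP.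
  have u_colour : vcolour u = false.
    by apply/asboolP => uv0; move/asboolP: e0_loop; rewrite e0v0 -uv0; apply.
  have top_conj v q h : s (vtop v q) * s (vbase v h) =
      s (vbase v (fun w => h (colour_act (vcolour v) w q))) * s (vtop v q).
    by rewrite -!gmulfM vtop_vbase.
  exists (s (vtop v0 g0) * (t e0 * s (vtop u g0) * (t e0)^-1)) => h.
  have tV h' : (t e0)^-1 * s (vbase v0 h') = s (vbase u h') * (t e0)^-1.
    by apply: (mulgI (t e0)); rewrite !mulgA mulgV mul1g e0_untw mulgK.
  rewrite -!mulgA tV (mulgA (s (vtop u g0))) top_conj -!mulgA.
  rewrite (mulgA (t e0)) e0_untw -!mulgA (mulgA (s (vtop v0 g0))) top_conj -!mulgA.
  by rewrite v0_colour u_colour.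
have [m m_gt0 zm] := Q_per z; have [h []] := shift_infinite_order m_gt0.
have iterE k : z ^+ k * s (vbase v0 h) = s (vbase v0 (iter k shift_fun h)) * z ^+ k.
  elim: k => [|k IH]; first by rewrite mul1g mulg1.
  by rewrite expgS -mulgA IH mulgA zE -mulgA.
have sM : {morph (s \o vbase v0) : g h / g * h}.
  by move=> g g' /=; rewrite vbaseM gmulfM.
apply: (hom_injective (f := make_hom sM) (faithful_all v0)) => /=.
by have := iterE m; rewrite zm mul1g mulg1.
Qed.

(** * Normal forms and residuality *)

(** Reduced words of the quotient by the base, the free product of the top
    groups A and of the free group on the stable letters; (e, b) is the stable
    letter of e, or its inverse if b is false. *)
Definition syllable : Type := ({classic vertex Gam} * A + {classic edge Gam} * bool)%type.

Definition syl_val (s : syllable) : Pi :=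
  match s with
  | inl (v, q) => vtop v q
  | inr (e, b) => if b then st e else (st e)^-1
  end.

Definition syl_proper (s : syllable) : Prop :=
  match s with inl (_, q) => q <> 1 | inr (e, _) => ~ T e end.

Definition syl_clash (s s' : syllable) : bool :=
  match s, s' with
  | inl (v, _), inl (v', _) => v == v'
  | inr (e, b), inr (e', b') => (e == e') && (b != b')
  | _, _ => false
  end.

Fixpoint reduced (l : seq syllable) : Prop :=
  if l is s :: l' then
    [/\ syl_proper s, (if l' is s' :: _ then ~~ syl_clash s s' else true) & reduced l']
  else True.

Definition syls_val (l : seq syllable) : Pi := foldr (fun s x => x * syl_val s) 1 l.

Lemma vbase_st e h : ~ T e -> st e * vbase v0 h = vbase v0 (twist e h) * st e.
Proof.
move=> nTe; rewrite (vbase_eq v0 (edge_end e true) (twist e h)) vbase_twist //.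
by rewrite mulgVK (vbase_eq v0 (edge_end e false)).
Qed.

Lemma vbase_stV e h : ~ T e -> (st e)^-1 * vbase v0 h = vbase v0 (untwist e h) * (st e)^-1.
Proof.
by move=> nTe; apply: (mulgI (st e)); rewrite !mulgA mulgV mul1g vbase_st // untwistK mulgK.
Qed.

(** Normality of the base, by which its elements are collected on the left. *)
Lemma syls_val_vbase l h : reduced l ->
  exists h', syls_val l * vbase v0 h = vbase v0 h' * syls_val l.
Proof.
elim: l h => [|s l IH] h /=; first by exists h; rewrite mulg1 mul1g.
case=> s_proper _ /IH l_base.
have [h' E] : exists h', syl_val s * vbase v0 h = vbase v0 h' * syl_val s.
  case: s s_proper => [[v q] _|[e []] /= nTe].
  - eexists; rewrite /= (vbase_eq v0 v h) vtop_vbase.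
    by rewrite (vbase_eq v v0).
  - by exists (twist e h); apply: vbase_st.
  - by exists (untwist e h); apply: vbase_stV.
have [h'' E'] := l_base h'.
by exists h''; rewrite -mulgA E mulgA E' mulgA.
Qed.

Definition has_normal_form (x : Pi) : Prop :=
  exists h l, reduced l /\ x = vbase v0 h * syls_val l.

Lemma normal_form_syl x s : syl_proper s ->
  has_normal_form x -> has_normal_form (x * syl_val s).
Proof.
move=> s_proper [h [l [l_red ->]]]; rewrite -mulgA.
suff [l' l'_red ->] : exists2 l', reduced l' & syls_val l * syl_val s = syls_val l'.
  by exists h, l'.
case: l l_red => [|s' l] l_red; first by exists [:: s].
case s_s': (syl_clash s s'); last by exists [:: s, s' & l] => //; split=> //; rewrite s_s'.
case: l_red => s'_proper s'_l l_red.
case: s s_proper s_s' => [[v q]|[e b]]; case: s' s'_proper s'_l => [[v' q']|[e' b']] //=.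
- move=> _ v'_l q1 /eqP vv'; rewrite -{}vv' in v'_l *.
  rewrite -mulgA -vtopM; have [qq1|qq1] := pselect (q' * q = 1).
    by exists l; rewrite // qq1 vtop1 mulg1.
  by exists (inl (v, q' * q) :: l) => //; split.
- move=> _ _ _ /andP[/eqP <- bb']; exists l => //.
  by case: b b' bb' => -[] //= _; rewrite ?mulgVK ?mulgK.
Qed.

Lemma normal_form_exists x : has_normal_form x.
Proof.
elim/pi1_ind: x => [|x v g x_nf|x e nTe x_nf|x e nTe x_nf].
- exists 1, [::]; split=> //=; rewrite mulg1.
  by rewrite vbase1.
- rewrite vincl_split mulgA.
  have {}x_nf : has_normal_form (x * vbase v g.1).
    case: x_nf => h [l [l_red ->]]; rewrite (vbase_eq v v0) -mulgA.
    have [h' ->] := syls_val_vbase g.1 l_red.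
    by exists (h * h'), l; rewrite vbaseM mulgA.
  have [->|q1] := pselect (g.2 = 1); last exact: (normal_form_syl (s := inl (v, g.2))).
  by rewrite vtop1 mulg1.
- exact: (normal_form_syl (s := inr (e, true))).
- exact: (normal_form_syl (s := inr (e, false))).
Qed.

(** The quotient by the base is embedded in a free product of copies of A only:
    the stable letter of e goes to x_e y_e, where x_e and y_e are the elements
    g0 of two new copies, of colours (e, true) and (e, false).  Reduced words
    go to reduced words: adjacent letters of a product of factors x_e y_e, or
    of their inverses, have different colours. *)
Definition colour : Type := {classic vertex Gam + edge Gam * bool}.

Definition syl_letters (s : syllable) : seq (colour * A) :=
  match s with
  | inl (v, q) => [:: (inl v : colour, q)]
  | inr (e, b) => let g := if b then g0 else g0^-1 in
      [:: (inr (e, ~~ b) : colour, g); (inr (e, b) : colour, g)]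
  end.

Definition syls_letters (l : seq syllable) := flatten (map syl_letters l).

Lemma syls_letters_alternating l : reduced l -> alternating (syls_letters l).
Proof.
elim: l => [|s l IH] //= [s_proper s_l /IH].
rewrite /syls_letters /= -/(syls_letters l).
(* A clash of the syllables is exactly a clash of the letters that meet, as the
   last letter read for (e, b) has colour (e, ~~ b) and the first (e, b). *)
have head_neq (d : colour) : (if l is s' :: _ then
      (if s' is inl (v, _) then d <> inl v else
       if s' is inr (e, b) then d <> inr (e, ~~ b) else True) else True) ->
    head_colour_neq d (syls_letters l).
  by case: (l) => [|[[v q]|[e b]] l'] //= /eqP.
case: s s_proper s_l => [[v q] /= /eqP q1|[e b] nTe] s_l l_alt /=.
  rewrite q1 l_alt andbT /=; apply: head_neq; case: (l) s_l => // -[[v' q']|[e b]] _ //=.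
  by move=> /eqP vv' [].
have -> : (if b then g0 else g0^-1) != 1 by case: (b); rewrite ?invg_eq1.
rewrite l_alt andbT /=; apply/andP; split; first by apply/eqP => -[]; case: (b).
apply: head_neq; case: (l) s_l => // -[[v' q']|[e' b']] _ //=.
by move=> eb [] ee bb; move: eb; rewrite ee bb eqxx; case: (b').
Qed.

(** Once the base is sent to 1 the edge relations become trivial, so the images
    of the top groups and of the stable letters can be chosen at will. *)
Lemma word_hom (Q : groupType) (rho : colour -> {multiplicative A -> Q}) :
  exists F : {multiplicative Pi -> Q},
    (forall h, F (vbase v0 h) = 1) /\
    (forall l, reduced l -> F (syls_val l) = word_value rho (syls_letters l)).
Proof.
pose f v (x : vgroup G v) : Q := rho (inl v : colour) x.2.
have fM v : {morph f v : x y / x * y} by move=> x y; rewrite /f gmulfM.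
have f_base v h : f v (wbase (colour_act (vcolour v)) h) = 1 by rewrite /f hom1.
pose fe e := rho (inr (e, true) : colour) g0 * rho (inr (e, false) : colour) g0.
have [e h Te|e h nTe|F [Fv Fe]] := @pi1_lift _ G T Q (fun v => make_hom (@fM v)) fe.
- by rewrite /= !f_base.
- by rewrite /= !f_base mulg1 mulgV.
exists F; split=> [h|]; first by rewrite /vbase Fv /= f_base.
elim=> [|s l IH] /=; first by rewrite hom1.
case=> s_proper _ /IH l_val.
rewrite gmulfM l_val /syls_letters /= word_value_cat; congr (_ * _).
case: s s_proper => [[v q]|[e []] /= nTe] /=.
- by rewrite mul1g /vtop Fv.
- by rewrite mul1g Fe.
- by rewrite mul1g homV Fe // /fe invgM !homV.
Qed.

Lemma residually_pi1 : residually C Pi.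
Proof.
suff hom_neq1 (x : Pi) : x <> 1 ->
    exists (Q : groupType) (s : {multiplicative Pi -> Q}), C Q /\ s x <> 1.
  move=> x /hom_neq1 [Q [s [CQ sx1]]].
  exists (im_group s), (corestrict s); split.
  - exact: class_image.
  - exact: corestrict_surj.
  - by move=> /(congr1 val).
have [h [[|s l] [l_red ->]]] := normal_form_exists x.
  rewrite mulg1 => vh1.
  have [[n w] hw1] : exists w, h w <> 1.
    apply: contrapT => /forallNP h1; apply: vh1.
    have -> : h = 1 by apply: functional_extensionality_dep => w; apply: contrapT.
    exact: vbase1.
  have [F FE] := level_hom n.
  exists (wreath A (det_act (lev n))), F; split.
    apply: class_wreath (det_class (lev n)) => //.
    exact: (class_power_seq C_root CA iN_inj (@det_code_inj _ _ _ _ (lev n))).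
  by rewrite FE => /(congr1 (fun x => x.1 w)).
move=> _; have alt := syls_letters_alternating l_red.
have [F [F_base F_val]] := word_hom (det_hom (alternating_detector C_root CA iN_inj alt)).
exists (det_group (alternating_detector C_root CA iN_inj alt)), F.
split; first exact: det_class.
rewrite gmulfM F_base mul1g F_val //; move: (alternating_detector _ _ _ _) => dt E.
have := @detector_moves _ _ _ _ dt; rewrite E act1; apply=> //.
by case: (s) => [[v q]|[e b]].
Qed.
End Pi1.
End Construction.

(** * The theorem *)

Lemma infinite_injection (X : choiceType) :
  infinite_set [set: X] -> exists f : nat -> X, injective f.
Proof.
move=> /infiniteP; case/card_leP => f.
exists (fun n => val (f (to_setT n))) => m n /val_inj E.
by have /(congr1 val) : to_setT m = to_setT n by apply: (inj (f := f)); rewrite ?in_setT.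
Qed.

Theorem theorem3 (C : group_class) (C_root : root_class C)
    (C_periodic : forall X : groupType, C X -> periodic X)
    (C_infinite : exists2 X : groupType, C X & infinite_set [set: X])
    (Gam : graph) (V_nonempty : inhabited (vertex Gam))
    (Gam_connected : connected_graph Gam) (E_nonempty : inhabited (edge Gam)) :
  exists G : graph_of_groups Gam,
    [/\ forall v : vertex Gam, C (vgroup G v),
        forall (e : edge Gam) (eps : bool), ~ trivial_set (edge_subgroup G e eps),
        forall T : set (edge Gam), maximal_tree T -> residually C (pi1 G T)
      & forall T : set (edge Gam), maximal_tree T ->
        forall (Q : groupType) (s : {multiplicative pi1 G T -> Q}),
          C Q -> surjective s ->
        forall (e : edge Gam) (eps : bool),
          ~ trivial_set (hom_ker s `&` pi1_edge_subgroup G T e eps)].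
Proof.
have [A CA A_inf] := C_infinite; have [iN iN_inj] := infinite_injection A_inf.
have [g0 g0_neq1] : exists g0 : A, g0 != 1.
  have [E|iN0] := eqVneq (iN 0) 1; last by exists (iN 0).
  by exists (iN 1%N); rewrite -E (inj_eq iN_inj).
case: E_nonempty => e0.
pose lev n := alternating_detector C_root CA iN_inj (ab_word_alternating g0_neq1 n).
exists (twisted_graph lev (edge_end e0 true)); split.
- exact: (class_vertex_group C_root CA iN_inj).
- exact: (edge_subgroup_nontrivial g0_neq1).
- by move=> T; apply: (residually_pi1 C_root CA iN_inj g0_neq1).
- move=> T T_tree Q s CQ _; apply: (periodic_quotient_kernel g0_neq1 T_tree) => //.
  + exact: C_periodic.
  + by exists e0.
Qed.
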